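(* Let $F$ be a field of characteristic zero, let $d_1,\dots,d_m$ be positive integers, and let $n=d_1+\cdots+d_m$. Consider $BT(d_1,\dots,d_m;F)$ with the grading induced by the Di Vincenzo--Vasilovsky $\mathbb{Z}_n$-grading of $M_n(F)$. Then every monomial identity of $BT(d_1,\dots,d_m;F)$ is a consequence of a monomial identity of $BT(d_1,\dots,d_m;F)$ of total degree at most $2n-2$.
   Context: All algebras are associative and unitary. $BT(d_1,\dots,d_m;F)$ is the subalgebra of $M_n(F)$ of block-upper-triangular matrices with diagonal blocks of sizes $d_1,\dots,d_m$: matrices $(A_{ij})_{1\le i,j\le m}$ with $A_{ij}\in M_{d_i\times d_j}(F)$ and $A_{ij}=0$ for $i>j$. The Di Vincenzo--Vasilovsky grading is $M_n(F)=\bigoplus_{t\in\mathbb{Z}_n}M_n^{(t)}$, where $M_n^{(t)}$ is the span of the elementary matrices $e_{ij}$ with $j-i\equiv t\pmod n$; $BT(d_1,\dots,d_m;F)$ is a graded subalgebra. $F\langle X|\mathbb{Z}_n\rangle$ is the free associative $\mathbb{Z}_n$-graded algebra on $X=\bigcup_{g\in\mathbb{Z}_n}X^g$, where the $X^g$ are disjoint countable sets of variables; variables in $X^g$ have degree $g$. A polynomial $f(x_1,\dots,x_t)\in F\langle X|\mathbb{Z}_n\rangle$ is a graded polynomial identity of a $\mathbb{Z}_n$-graded algebra $A$ if $f(a_1,\dots,a_t)=0$ whenever $a_k\in A^{\deg(x_k)}$ for all $k$. A monomial identity of $A$ is a monomial that is a graded polynomial identity of $A$. A $T_{\mathbb{Z}_n}$-ideal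 is an ideal of $F\langle X|\mathbb{Z}_n\rangle$ invariant under all degree-preserving algebra endomorphisms; a polynomial is a consequence of (follows from) another one if it lies in the $T_{\mathbb{Z}_n}$-ideal generated by it. The total degree of a monomial is the number of variables in it, counted with multiplicity. *)

(* Defs.v *)
From HB Require Import structures.
From mathcomp Require Import all_boot all_order all_algebra finmap.
From mathcomp Require Import monalg.

Set Implicit Arguments.
Unset Strict Implicit.
Unset Printing Implicit Defensive.

Import GRing.Theory.
Local Open Scope ring_scope.

(* Elements of Z_n are represented by their residues in 'I_n, and the group law
   of Z_n by congruence modulo n; unlike 'Z_n, this is also right for n = 1.
   The variable (g, k) is the k-th variable of X^g. *)
Definition gvar (n : nat) : choiceType := ('I_n * nat)%type.

Definition vdeg (n : nat) (x : gvar n) : 'I_n := x.1.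

Definition gmonom (n : nat) : monomType := {fmonom (gvar n)}.

Definition free_galg (F : fieldType) (n : nat) : lalgType F :=
  {malg F[gmonom n]}.

Definition monomial (F : fieldType) (n : nat) (w : gmonom n) : free_galg F n :=
  << w >>.

Definition homogeneous (F : fieldType) (n : nat) (g : 'I_n)
    (f : free_galg F n) : Prop :=
  forall w : gmonom n, w \in msupp f ->
    (\sum_(x <- (w : {fmonom (gvar n)})) vdeg x = g %[mod n])%N.

Definition degree_preserving (F : fieldType) (n : nat)
    (phi : free_galg F n -> free_galg F n) : Prop :=
  forall (g : 'I_n) (f : free_galg F n),
    homogeneous g f -> homogeneous g (phi f).

(* Closure under scalars follows from the ideal axioms, since c *: f = c%:A * f *)
Record is_Tideal (F : fieldType) (n : nat) (I : free_galg F n -> Prop) : Prop :=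
  IsTideal {
    Tideal0 : I 0;
    TidealD : forall f g, I f -> I g -> I (f + g);
    TidealMl : forall h f, I f -> I (h * f);
    TidealMr : forall h f, I f -> I (f * h);
    Tideal_endo : forall phi : {lrmorphism free_galg F n -> free_galg F n},
      degree_preserving phi -> forall f, I f -> I (phi f)
  }.

Definition Tideal_gen (F : fieldType) (n : nat) (f : free_galg F n)
    (g : free_galg F n) : Prop :=
  forall I : free_galg F n -> Prop, is_Tideal I -> I f -> I g.

Definition consequence (F : fieldType) (n : nat)
    (g f : free_galg F n) : Prop := Tideal_gen f g.

(* Written out rather than through mmap, whose target must be a nontrivial ring,
   a structure 'M[F]_n only has when n is syntactically a successor. *)
Definition geval (F : fieldType) (n : nat) (a : gvar n -> 'M[F]_n)
    (f : free_galg F n) : 'M[F]_n :=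
  \sum_(w <- msupp f) f@_w *: \prod_(x <- (w : {fmonom (gvar n)})) a x.

(* A Z_n-graded subalgebra of 'M[F]_n is given by its homogeneous components. *)
Definition graded_identity (F : fieldType) (n : nat)
    (A : 'I_n -> 'M[F]_n -> Prop) (f : free_galg F n) : Prop :=
  forall a : gvar n -> 'M[F]_n,
    (forall x : gvar n, A (vdeg x) (a x)) -> geval a f = 0.

Definition monomial_identity (F : fieldType) (n : nat)
    (A : 'I_n -> 'M[F]_n -> Prop) (w : gmonom n) : Prop :=
  graded_identity A (monomial F w).

Definition DV_component (F : fieldType) (n : nat) (t : 'I_n) :
    {vspace 'M[F]_n} :=
  (\sum_(p : 'I_n * 'I_n | p.2 == p.1 + t %[mod n])
     <[delta_mx p.1 p.2 : 'M[F]_n]>)%VS.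

Definition BT (F : fieldType) (m : nat) (d : 'I_m -> nat)
    (A : 'M[F]_(\sum_(i < m) d i)) : Prop :=
  forall i j : 'I_m, (j < i)%N -> submxblock A i j = 0.

Definition BT_component (F : fieldType) (m : nat) (d : 'I_m -> nat)
    (t : 'I_(\sum_(i < m) d i)) (A : 'M[F]_(\sum_(i < m) d i)) : Prop :=
  BT A /\ A \in DV_component F t.
Arguments BT_component F {m} d t A.

(* Main.v *)
From HB Require Import structures.
Require Import Defs.
From mathcomp Require Import all_boot all_order all_algebra finmap.
From mathcomp Require Import monalg zify.

Import GRing.Theory.
Local Open Scope ring_scope.

(** A homogeneous matrix of degree t in the block-triangular algebra has nonzero
    entries only at the positions (p, p + t) for which the block of p does not
    exceed the block of p + t, so evaluating a word moves each start i along one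
    walk: i, i + g_1, i + g_1 + g_2, and so on, where the g_j are the degrees of
    the letters. The evaluation vanishes on this row as soon as the block number
    drops between two consecutive times; if it never drops, evaluating all letters
    at the 0-1 matrices of maximal support gives a product with an entry 1.
    Hence ([monomial_identityP]) a word is an identity exactly when it is blocked,
    that is, every one of the n walks has two times, not necessarily
    consecutive, between which the block number drops.

    The proof removes letters one at a time. Merging two adjacent letters into a
    new variable of the summed degree, or removing the first or the last letter,
    erases exactly one time from all walks, and the longer word is a consequence
    of the shorter one ([delete_time]). The result is still blocked if each walk
    keeps a pair of times witnessing its drop. So it is enough to find at most
    2n - 1 times containing a witnessing pair for each of the n walks
    ([few_times]): a word of length greater than 2n - 2 has at least 2n times, and
    one of these can be erased.

    Choosing the pairs independently would give 2n times. One time is saved by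
    choosing a start p0 in a highest block and the first time t0 at which
    the walks have moved. The walk that arrives at p0 at time t0 has not dropped by
    then, so it drops to a lower block later, and as p0 is in a highest block, t0 is
    the first time of a witnessing pair. The walk that starts at p0 is a different
    one: it is either lower at t0 than at time 0, or still in a highest block at t0
    and drops later; in both cases it has a witnessing pair that contains t0. *)

(** * Walks on the cyclic index set *)

Definition shift {n : nat} (p : 'I_n) (k : nat) : 'I_n :=
  Ordinal (ltn_pmod (p + k) (leq_ltn_trans (leq0n p) (ltn_ord p))).

Lemma shiftD n (p : 'I_n) k l : shift p (k + l) = shift (shift p k) l.
Proof. by apply: val_inj; rewrite /= modnDml addnA. Qed.

Lemma eq_shift n (p : 'I_n) k l : k = l %[mod n] -> shift p k = shift p l.
Proof. by move=> kl; apply: val_inj; rewrite /= -modnDmr kl modnDmr. Qed.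

Lemma shift_mod0 n (p : 'I_n) k : k = 0 %[mod n] -> shift p k = p.
Proof. by move=> /eq_shift ->; apply: val_inj; rewrite /= addn0 modn_small. Qed.

Lemma shift_surj n (p : 'I_n) k : exists q : 'I_n, shift q k = p.
Proof.
exists (shift p (k * n.-1)); rewrite -shiftD shift_mod0 // -mulnSr prednK.
  by rewrite modnMl mod0n.
exact: leq_ltn_trans (leq0n p) (ltn_ord p).
Qed.

Definition degsum {n : nat} (w : seq (gvar n)) : nat := (\sum_(x <- w) vdeg x)%N.

(** Time k lies between the k-th letter and the next one, so a word has one more
    time than letters. *)
Definition walk {n : nat} (w : seq (gvar n)) (i : 'I_n) (k : nat) : 'I_n :=
  shift i (degsum (take k w)).

Lemma walk0 n (w : seq (gvar n)) i : walk w i 0 = i.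
Proof. by rewrite /walk take0 /degsum big_nil shift_mod0. Qed.

Lemma walk_cons n x (w : seq (gvar n)) i k :
  walk (x :: w) i k.+1 = walk w (shift i (vdeg x)) k.
Proof. by rewrite /walk /= /degsum big_cons shiftD. Qed.

Definition descent {n : nat} (b : 'I_n -> nat) (w : seq (gvar n)) (i : 'I_n)
    (k l : nat) : Prop :=
  [/\ (k < l)%N, (l <= size w)%N & (b (walk w i l) < b (walk w i k))%N].

Definition blocked {n : nat} (b : 'I_n -> nat) (w : seq (gvar n)) : Prop :=
  forall i, exists k l, descent b w i k l.

(** A drop between two distant times forces a drop between consecutive ones.
    Blocked words are defined with distant times because such pairs, unlike
    the consecutive ones, survive the erasure of a time between them. *)
Lemma step_descent n (b : 'I_n -> nat) w i :
  (forall k, k < size w -> b (walk w i k) <= b (walk w i k.+1))%N ->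
  forall k l, ~ descent b w i k l.
Proof.
move=> up k l [kl lw]; apply/negP; rewrite -leqNgt.
elim: l kl lw => // l IHl; rewrite ltnS leq_eqVlt => /orP[/eqP<-|kl] lw.
  exact: up.
exact: leq_trans (IHl kl (ltnW lw)) (up l lw).
Qed.

(** One pair of times per walk would give 2n; the pairs of the walks starting at
    [p0] and [q0] below share the time [t0]. *)
Lemma few_times n (b : 'I_n -> nat) (w : seq (gvar n)) :
  (0 < n)%N -> blocked b w ->
  exists2 C : seq nat, (size C <= 2 * n - 1)%N
    & forall i, exists k l, [/\ k \in C, l \in C & descent b w i k l].
Proof.
case: n b w => // n b w _ blk.
have [p0 _ p0max] : exists2 p0 : 'I_n.+1, true & forall p, (b p <= b p0)%N.
  by exists [arg max_(p > ord0) b p] => //; case: arg_maxnP => // p _ + q; apply.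
pose moved t := (t <= size w)%N && (degsum (take t w) %% n.+1 != 0)%N.
have stay t : (t <= size w)%N -> ~~ moved t -> forall p, walk w p t = p.
  move=> tw; rewrite /moved tw negbK => /eqP t0 p.
  by rewrite /walk shift_mod0 // mod0n.
have /ex_minnP[t0 /andP[t0w t0n] t0min] : exists t, moved t.
  have [k [l [kl lw]]] := blk p0.
  have kw := ltnW (leq_trans kl lw).
  have [mk|/(stay _ kw) ->] := boolP (moved k); first by exists k.
  have [ml|/(stay _ lw) ->] := boolP (moved l); first by exists l.
  by rewrite ltnn.
have stay0 t p : (t < t0)%N -> walk w p t = p.
  move=> tt0; apply: stay; first by lia.
  by apply/negP => /t0min; rewrite leqNgt tt0.
(* A walk in a highest block at t0 rests at its start before t0 and does not drop
   on arriving, so its drop ends after t0; then it also drops from t0, where it is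
   as high as possible. *)
have late p : b (walk w p t0) = b p0 -> exists l, descent b w p t0 l.
  move=> pt0; have [k [l [kl lw lk]]] := blk p.
  have lt0 : (t0 < l)%N.
    rewrite ltnNge; apply/negP; rewrite leq_eqVlt => /orP[/eqP El|lt0].
      by move: lk; rewrite El pt0 ltnNge p0max.
    by move: lk; rewrite !stay0 ?ltnn // (ltn_trans kl).
  exists l; split=> //; rewrite pt0.
  exact: leq_trans lk (p0max _).
(* [q0] differs from [p0], since at t0 the walks have moved. *)
have [q0 q0t0] : exists q0, walk w q0 t0 = p0 by exact: shift_surj.
have q0p0 : q0 != p0.
  apply/eqP => q0E; move: q0t0 t0n; rewrite q0E /walk => /(congr1 val) /= E.
  move: E; rewrite -[RHS](modn_small (ltn_ord p0)) -{2}(addn0 p0).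
  by move/eqP; rewrite eqn_modDl mod0n => ->.
have [lq dq] := late q0 (congr1 b q0t0).
(* The pair of [p0] is (0, t0) or (t0, l): one time besides t0 suffices. *)
have [tp [k [l [dp kC lC]]]] : exists tp k l,
    [/\ descent b w p0 k l, k \in [:: t0; tp] & l \in [:: t0; tp]].
  have [Ep|Np] := eqVneq (b (walk w p0 t0)) (b p0).
    have [l dl] := late p0 Ep; exists l, t0, l.
    by rewrite !inE !eqxx orbT.
  exists 0%N, 0%N, t0; rewrite !inE !eqxx orbT; split=> //; split=> //.
    rewrite lt0n; apply: contra_neq Np => ->; by rewrite walk0.
  by rewrite walk0 ltn_neqAle Np p0max.
have /fin_all_exists[kf /fin_all_exists[lf df]] := blk.
pose rest := enum (predC (pred2 p0 q0)).
exists [:: t0, lq, tp & [seq kf i | i <- rest] ++ [seq lf i | i <- rest]].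
  have : (2 + size rest = n.+1)%N.
    by rewrite -cardE -[RHS]card_ord -(cardC (pred2 p0 q0)) card2 eq_sym q0p0.
  rewrite /= size_cat !size_map; lia.
move=> i; have [irest|] := boolP (i \in rest).
  by exists (kf i), (lf i); rewrite !inE !mem_cat !map_f ?orbT.
rewrite mem_enum !inE negbK => /orP[]/eqP->.
  exists k, l; split=> //; [move: kC | move: lC];
    by rewrite !inE => /orP[] ->; rewrite ?orbT.
by exists t0, lq; rewrite !inE !eqxx ?orbT.
Qed.

(** * Deleting one time of a walk by a graded substitution *)

Lemma congr_sum n (I : Type) (r : seq I) (f g : I -> nat) :
  (forall i, f i = g i %[mod n])%N ->
  (\sum_(i <- r) f i = \sum_(i <- r) g i %[mod n])%N.
Proof.
move=> fg; apply: (big_ind2 (fun u v => u = v %[mod n])) => // u u' v v' uu' vv'.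
by rewrite -modnDm uu' vv' modnDm.
Qed.

Lemma monomialM (F : fieldType) n (u v : gmonom n) :
  monomial F (mmul u v) = monomial F u * monomial F v.
Proof. by rewrite /monomial malgM_def fgmulUU mulr1. Qed.

Lemma fmonomM (I : choiceType) (u v : seq I) :
  FMonom (u ++ v) = mmul (FMonom u) (FMonom v) :> {fmonom I}.
Proof. by apply/eqP; rewrite fmP fmM. Qed.

(** A consequence is obtained by substituting words for variables. To be used in a
    T-ideal, the substitution [s] has to be extended to an algebra endomorphism, and
    this preserves degrees as soon as [s] does so on variables. *)
Section GradedSubstitution.

Variables (F : fieldType) (n : nat) (s : gvar n -> seq (gvar n)).

Definition subst_word (w : gmonom n) : free_galg F n :=
  monomial F (FMonom (flatten (map s w)) : gmonom n).

Fact subst_word_mmorphism : mmorphism subst_word.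
Proof.
split=> [u v|]; last first.
  by rewrite /subst_word fm1 /monomial -fmoneE.
by rewrite /subst_word fmM map_cat flatten_cat fmonomM monomialM.
Qed.

HB.instance Definition _ :=
  isMultiplicative.Build (gmonom n) (free_galg F n) subst_word subst_word_mmorphism.

Definition subst (f : free_galg F n) : free_galg F n :=
  mmap (@mkmalgU (gmonom n) F mone) subst_word f.

Fact subst_is_additive : additive subst.
Proof. exact: mmap_is_additive. Qed.

HB.instance Definition _ :=
  GRing.isAdditive.Build (free_galg F n) (free_galg F n) subst subst_is_additive.

Fact subst_is_multiplicative : multiplicative subst.
Proof.
(* The free algebra is not commutative, but scalars are central in it. *)
apply: commr_mmap_is_multiplicative => g m m'.
by rewrite /GRing.comm !malgM_def !fgmulUU mulm1 mul1m mulrC.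
Qed.

HB.instance Definition _ :=
  GRing.isMultiplicative.Build (free_galg F n) (free_galg F n) subst
    subst_is_multiplicative.

Fact subst_is_scalable : scalable subst.
Proof. by move=> c g; rewrite /subst mmapZ mul_malgC. Qed.

HB.instance Definition _ :=
  GRing.isScalable.Build F (free_galg F n) (free_galg F n) *:%R subst
    subst_is_scalable.

Lemma subst_monomial (w : gmonom n) :
  subst (monomial F w) = monomial F (FMonom (flatten (map s w)) : gmonom n).
Proof. by rewrite /subst mmapU mul1r. Qed.

Lemma subst_degree_preserving :
  (forall x, degsum (s x) = vdeg x %[mod n]) -> degree_preserving subst.
Proof.
move=> sdeg g f fg w; rewrite -mcoeff_neq0 /subst mmapE raddf_sum /=.
have [/hasP[u uf /eqP->] _|/hasPn nw] :=
    boolP (has (fun u : gmonom n => w == FMonom (flatten (map s u))) (msupp f)).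
  rewrite -(fg u uf) big_flatten /= big_map; exact: congr_sum.
rewrite big_seq big1 ?eqxx // => u uf.
rewrite mul_malgC mcoeffZ /subst_word /monomial mcoeffU eq_sym.
by rewrite (negPf (nw u uf)) mulr0.
Qed.

End GradedSubstitution.

Lemma flatten_map_eq1 (T : eqType) (f : T -> seq T) (r : seq T) :
  {in r, forall x, f x = [:: x]} -> flatten (map f r) = r.
Proof.
elim: r => //= x r IHr fr; rewrite fr ?mem_head // IHr // => y yr.
by rewrite fr // inE yr orbT.
Qed.

Lemma fresh_var n (g : 'I_n) (r : seq (gvar n)) :
  exists2 z : gvar n, vdeg z = g & z \notin r.
Proof.
exists ((g, (\max_(x <- r) x.2).+1) : gvar n) => //; apply/negP => zr.
by have := leq_bigmax_seq (P := xpredT) (F := snd) _ zr isT; rewrite ltnn.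
Qed.

(** Time 0 is erased by removing the first letter, the last time by removing
    the last letter, any other time by merging the two letters around it into a
    fresh variable. The offset [c] is the degree of a removed first letter: the
    walks of the shorter word then start one step later. *)
Lemma delete_time (F : fieldType) n (w : seq (gvar n)) t :
  (0 < size w)%N -> (t <= size w)%N ->
  exists (v : seq (gvar n)) (c : nat),
    [/\ size v = (size w).-1,
        forall k, (k <= size v)%N ->
          (c + degsum (take k v) = degsum (take (bump t k) w) %[mod n])%N
      & consequence (monomial F (FMonom w : gmonom n))
                    (monomial F (FMonom v : gmonom n))].
Proof.
case: t => [|t].
  case: w => // x v _ _; exists v, (vdeg x); split=> // [k _|I TI Iv].
    by rewrite /bump leq0n add1n /= /degsum big_cons.
  by rewrite -cat1s fmonomM monomialM; apply: TidealMl.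
move=> w0; rewrite leq_eqVlt => /orP[/eqP tw|tw].
  case/lastP: w w0 tw => // v x _; rewrite size_rcons => -[->].
  exists v, 0%N; split=> // [k kv|I TI Iv].
    rewrite add0n /bump ltnNge kv /= add0n -cats1 takel_cat //.
  by rewrite -cats1 fmonomM monomialM; apply: TidealMr.
have [a [x [y [b [-> {w w0 tw}<-]]]]] :
    exists a x y b, w = a ++ [:: x, y & b] /\ size a = t.
  have: (1 < size (drop t w))%N by rewrite size_drop ltn_subRL addn1.
  case Ew: (drop t w) => [|x [|y b]] // _; exists (take t w), x, y, b.
  by rewrite -Ew cat_take_drop size_takel // ltnW // ltnW.
have [z zdeg] := fresh_var n (shift (vdeg x) (vdeg y)) (a ++ b).
rewrite mem_cat negb_or => /andP[za zb].
exists (a ++ z :: b), 0%N; split=> [|k kv|I TI Iv].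
- by rewrite !size_cat /= !addnS.
- rewrite add0n; have [ka|] := leqP k (size a).
    by rewrite /bump ltnNge ka /= add0n !takel_cat.
  move=> ak; rewrite /bump ak add1n !take_cat !ltnNge leqW ?(ltnW ak) //=.
  rewrite subSn ?(ltnW ak) //; case: (k - size a)%N (subn_gt0 (size a) k) => [|j].
    by rewrite ak.
  move=> _ /=; rewrite /degsum !big_cat !big_cons /= zdeg /=.
  by rewrite -modnDmr modnDml modnDmr -addnA.
(* As [z] is fresh, the substitution splits the merged letter and nothing else. *)
pose s u := if u == z then [:: x; y] else [:: u].
have -> : a ++ [:: x, y & b] = flatten (map s (a ++ z :: b)).
  rewrite map_cat flatten_cat /= {2}/s eqxx !flatten_map_eq1 // => u uI.
    by rewrite /s; case: eqP => // uz; rewrite -uz uI in zb.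
  by rewrite /s; case: eqP => // uz; rewrite -uz uI in za.
rewrite -(subst_monomial F n s (FMonom (a ++ z :: b))).
apply: Tideal_endo => //; apply: subst_degree_preserving => u.
rewrite /s /degsum; case: eqP => [->|_]; last by rewrite big_seq1.
by rewrite !big_cons big_nil addn0 zdeg /= modn_mod.
Qed.

(** * Monomial identities are blocked words *)

Lemma DV_componentP (F : fieldType) n (t : 'I_n) (A : 'M[F]_n) :
  A \in DV_component F t <-> forall p q, A p q != 0 -> q = shift p t.
Proof.
split=> [/memv_sumP[v vD ->] p q|AD].
  rewrite summxE => /eqP nz; apply/eqP/negPn/negP => qp; apply: nz.
  apply: big1 => -[i j] /= ij; have /vlineP[c ->] := vD (i, j) ij.
  rewrite !mxE; case: eqP => [pi|]; last by rewrite mulr0.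
  case: eqP => [qj|]; last by rewrite mulr0.
  case/negP: qp; rewrite -val_eqE /= pi qj -(eqP ij) modn_small //.
rewrite [A]matrix_sum_delta; apply: memv_suml => p _; apply: memv_suml => q _.
have [->|/AD qE] := eqVneq (A p q) 0; first by rewrite scale0r mem0v.
apply: memvZ; rewrite /DV_component.
apply: (subvP (sumv_sup (p, q) _ (subvv _))) (memv_line _).
by rewrite qE /= modn_mod.
Qed.

Lemma BTP (F : fieldType) m (d : 'I_m -> nat) (A : 'M[F]_(\sum_(i < m) d i)) :
  BT A <-> forall p q, A p q != 0 -> (tagnat.sig1 p <= tagnat.sig1 q)%N.
Proof.
split=> [BA p q|AB i j ji].
  apply: contraR; rewrite -ltnNge => qp; apply/eqP.
  have /matrixP/(_ (tagnat.sig2 p) (tagnat.sig2 q)) := BA _ _ qp.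
  by rewrite !mxE !tagnat.sig2K.
apply/matrixP => k l; rewrite !mxE; apply/eqP; apply: contraLR ji => /AB.
by rewrite !tagnat.Rank1K -leqNgt.
Qed.

Lemma BT_componentP (F : fieldType) m (d : 'I_m -> nat) t
    (A : 'M[F]_(\sum_(i < m) d i)) :
  BT_component F d t A <-> forall p q, A p q != 0 ->
    q = shift p t /\ (tagnat.sig1 p <= tagnat.sig1 q)%N.
Proof.
split=> [[/BTP BA /DV_componentP DA] p q pq|AP]; first by split; [apply: DA|apply: BA].
by split; [apply/BTP|apply/DV_componentP] => p q /AP[].
Qed.

Lemma geval_monomial (F : fieldType) n (a : gvar n -> 'M[F]_n) (w : seq (gvar n)) :
  geval a (monomial F (FMonom w : gmonom n)) = \prod_(x <- w) a x.
Proof.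
by rewrite /geval /monomial msuppU1 big_seq_fset1 mcoeffUU scale1r.
Qed.

(** A nonzero entry of the product expands into a product of nonzero entries of the
    factors, and these leave no choice but to follow the walk. *)
Lemma prod_entry_walk (F : fieldType) n (b : 'I_n -> nat) (a : gvar n -> 'M[F]_n) :
  (forall x p q, a x p q != 0 -> q = shift p (vdeg x) /\ (b p <= b q)%N) ->
  forall w i j, (\prod_(x <- w) a x) i j != 0 ->
  forall k, (k < size w)%N -> (b (walk w i k) <= b (walk w i k.+1))%N.
Proof.
move=> aP; elim=> // x w IHw i j.
rewrite big_cons [_ * _]/(_ *m _) mxE => nz.
have [p /andP[]] : exists p, (a x i p != 0) && ((\prod_(y <- w) a y) p j != 0).
  apply/existsP; apply: contraNT nz => /existsPn nz; apply/eqP/big1 => p _.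
  by apply/eqP; rewrite mulf_eq0 -[_ || _]negbK negb_or nz.
move=> /aP[pE ip] /IHw pw [|k] kw.
  by rewrite walk_cons !walk0 -pE.
by rewrite !walk_cons -pE; apply: pw.
Qed.

(** The sum of all matrix units of the degree of [x] along which [b] does not
    drop: the homogeneous element that can detect every unblocked walk. *)
Definition step_mx (F : fieldType) {n : nat} (b : 'I_n -> nat) (x : gvar n) : 'M[F]_n :=
  \matrix_(p, q) ((q == shift p (vdeg x)) && (b p <= b q)%N)%:R.

Lemma step_mx_prod (F : fieldType) n (b : 'I_n -> nat) w i :
  (forall k, k < size w -> b (walk w i k) <= b (walk w i k.+1))%N ->
  (\prod_(x <- w) step_mx F b x) i (walk w i (size w)) = 1.
Proof.
elim: w i => [|x w IHw] i up; first by rewrite big_nil walk0 mxE eqxx.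
rewrite big_cons [_ * _]/(_ *m _) mxE (bigD1 (shift i (vdeg x))) //=.
rewrite [X in _ + X]big1 => [|p /negPf pE]; last by rewrite mxE pE mul0r.
have := up 0%N isT; rewrite walk_cons !walk0 => b0.
rewrite walk_cons IHw => [|k kw]; first by rewrite mxE eqxx b0 mulr1 addr0.
by have := up k.+1 kw; rewrite !walk_cons.
Qed.

Lemma monomial_identityP (F : fieldType) m (d : 'I_m -> nat)
    (w : seq (gvar (\sum_(i < m) d i))) :
  monomial_identity (BT_component F d)
    (FMonom w : gmonom (\sum_(i < m) d i)) <->
  blocked (fun p => tagnat.sig1 p : nat) w.
Proof.
pose b (p : 'I_(\sum_(i < m) d i)) : nat := tagnat.sig1 p.
split=> [idw i|blk a aP].
  have [/forallP up|/forallPn[k]] := boolP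
    [forall k : 'I_(size w), b (walk w i k) <= b (walk w i k.+1)]%N; last first.
    by rewrite -ltnNge => dn; exists k, k.+1; split.
  have: geval (step_mx F b) (monomial F (FMonom w : gmonom _)) = 0.
    apply: idw => x; apply/BT_componentP => p q; rewrite mxE.
    by case: andP => [[/eqP]|]; rewrite ?eqxx.
  rewrite geval_monomial => /matrixP/(_ i (walk w i (size w))).
  rewrite step_mx_prod ?mxE => [/eqP|k kw]; first by rewrite oner_eq0.
  exact: (up (Ordinal kw)).
rewrite geval_monomial; apply/matrixP => i j; rewrite [RHS]mxE.
apply/eqP/negPn/negP => nz; have [k [l]] := blk i.
apply: (step_descent _ b w i) => r; apply: prod_entry_walk nz r => x p q.
by apply/BT_componentP: p q; apply: aP.
Qed.

(** Induction on the length: as long as there are more times than [few_times]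
    asks for, a superfluous one is erased. *)
Lemma short_consequence (F : fieldType) n (b : 'I_n -> nat) (w : seq (gvar n)) :
  (0 < n)%N -> blocked b w ->
  exists u : seq (gvar n),
    [/\ blocked b u, (size u <= 2 * n - 2)%N
      & consequence (monomial F (FMonom w : gmonom n))
                    (monomial F (FMonom u : gmonom n))].
Proof.
move=> n0; have [N] := ubnP (size w); elim: N w => // N IHN w wN blk.
have [short|long] := leqP (size w) (2 * n - 2); first by exists w; split.
have [C szC CP] := few_times n b w n0 blk.
have [t tw tC] : exists2 t, (t <= size w)%N & t \notin C.
  have /allPn[t] : ~~ all (mem C) (iota 0 (size w).+1).
    apply/negP => /allP sub.
    have := uniq_leq_size (s2 := C) (iota_uniq 0 (size w).+1) sub.
    rewrite size_iota => /leq_trans/(_ szC).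
    by move: long n0; move: (size w) => N1; lia.
  by rewrite mem_iota ltnS => tw tC; exists t.
have [v [c [szv vw wv]]] := delete_time F n w t (leq_ltn_trans (leq0n _) long) tw.
have walkE i k : (k <= size v)%N -> walk v (shift i c) k = walk w i (bump t k).
  by move=> kv; rewrite /walk -shiftD; apply: eq_shift; apply: vw.
(* The shorter word keeps the witnessing pairs, renumbered by [unbump t]. *)
have vblk : blocked b v.
  move=> j; have [i <-] := shift_surj n j c.
  have [k [l [kC lC [kl lw dn]]]] := CP i.
  have kt : k != t by apply: contraNneq tC => <-.
  have lt : l != t by apply: contraNneq tC => <-.
  have uE r : r != t -> bump t (unbump t r) = r.
    by move=> rt; apply: unbumpK; rewrite inE.
  have lv : (unbump t l <= size v)%N.
    by rewrite szv; move: lt lw tw; rewrite /unbump; case: ltnP; lia.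
  have kl' : (unbump t k < unbump t l)%N.
    by move: kt lt kl; rewrite /unbump; do 2 case: ltnP; lia.
  exists (unbump t k), (unbump t l); split=> //.
  by rewrite !walkE ?uE // (leq_trans (ltnW kl')).
have [|u [ublk szu vu]] := IHN v _ vblk; first by rewrite szv; lia.
by exists u; split=> // I TI Iu; apply: wv => //; apply: vu.
Qed.

Theorem proposition12 (F : fieldType) (charF0 : [pchar F] =i pred0)
    (m : nat) (m_gt0 : (0 < m)%N)
    (d : 'I_m -> nat) (d_gt0 : forall i : 'I_m, (0 < d i)%N)
    (w : gmonom (\sum_(i < m) d i)) :
  monomial_identity (BT_component F d) w ->
  exists u : gmonom (\sum_(i < m) d i),
    [/\ monomial_identity (BT_component F d) u,
        (fdeg u <= 2 * (\sum_(i < m) d i) - 2)%N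
      & consequence (monomial F w) (monomial F u)].
Proof.
rewrite -(fmK w) => /monomial_identityP wblk.
have n_gt0 : (0 < \sum_(i < m) d i)%N.
  by rewrite (bigD1 (Ordinal m_gt0)) //= addn_gt0 d_gt0.
have [u [ublk szu wu]] := short_consequence F _ _ _ n_gt0 wblk.
exists (FMonom u : gmonom _); split=> //.
exact/monomial_identityP.
Qed.
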